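(* Let $E,A\in\mathbb{C}^{n\times n}$, $B\in\mathbb{C}^{n\times m}$, $C\in\mathbb{C}^{p\times n}$, let $H(z)=C(zE-A)^{-1}B$, and let $\delta>0$ be fixed. Let $z_1,\ldots,z_S\in\mathbb{C}$ be distinct points such that $z_jE-A$ is invertible for all $j$, let $q_1,\ldots,q_S\in\mathbb{C}\setminus\{0\}$, and let $\widetilde{H}$ be the interpolatory barycentric function $$\widetilde{H}(z)=\sum_{j=1}^S\frac{q_jH(z_j)}{z-z_j}\Bigg/\sum_{j=1}^S\frac{q_j}{z-z_j}.$$ Then there exist a matrix $\widetilde{B}\in\mathbb{C}^{n\times m}$ and a constant $\gamma>0$, both depending only on $q_1,\ldots,q_S$, on $z_1,\ldots,z_S$, and on the system matrices $E,A,B,C$ (in particular, independent of $z$), such that the relative approximation error $$\varepsilon(\widetilde{H},z)=\frac{\|\widetilde{H}(z)-H(z)\|}{\|H(z)\|+\delta}$$ satisfies $$\varepsilon(\widetilde{H},z)=\Delta(z)\left|\sum_{j=1}^S\frac{q_j}{z-z_j}\right|^{-1}$$ for all $z\in\mathbb{C}$ such that $zE-A$ is invertible and $\sum_{j=1}^S q_j/(z-z_j)\neq 0$ (with the convention in the context at $z=z_i$), where, for all $z\in\mathbb{C}$ such that $zE-A$ is invertible, $$\Delta(z):=\frac{\|C(zE-A)^{-1}\widetilde{B}\|}{\|C(zE-A)^{-1}B\|+\delta}\leq\gamma\,\frac{\|(zE-A)^{-1}\|_\star}{\|C(zE-A)^{-1}B\|+\delta}.$$ Additionally, assume that all eigenvalues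 of the pencil $(A,E)$ are poles of $H$, and that their multiplicities as eigenvalues equal their orders as poles of $H$ (i.e., that $B$ and $C$ are in general position with respect to the generalized eigenspaces of $(A,E)$). Then $\Delta$ is uniformly bounded from above by a global ($z$-independent) constant $\bar{\Delta}$, depending only on the system matrices and on $\gamma$ (with $\delta$ fixed): $\Delta(z)\leq\bar{\Delta}$ for all $z\in\mathbb{C}$ such that $zE-A$ is invertible.
   Context: $\|\cdot\|$ denotes the Frobenius norm of a matrix and $\|\cdot\|_\star$ its spectral norm (largest singular value). $H$ is the output transfer function of the descriptor system $zEX(z)=AX(z)+BU(z)$, $Y(z)=CX(z)$. The eigenvalues of the pencil $(A,E)$ are the $\lambda\in\mathbb{C}$ for which $\lambda E-A$ is singular; the poles of $H$ are the frequency values at which $H$ is unbounded. The parameter $\delta$ is a fixed small positive number that prevents division by zero at zeros of $H$. At a support point $z_i$, the barycentric quotient is defined by removing the removable discontinuity, i.e. $\widetilde{H}(z_i):=\lim_{z\to z_i}\widetilde{H}(z)=H(z_i)$; correspondingly, $\left|\sum_{j=1}^S q_j/(z-z_j)\right|^{-1}$ is understood as its limit, $0$, at $z=z_i$, and $z=z_i$ is included among the admissible values of $z$. *)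

(* Defs.v *)
(* MathComp / MathComp-Analysis; the complex numbers are [R[i]], [R : realType]. *)
From mathcomp Require Import all_boot all_order all_algebra.
From mathcomp Require Export complex.
From mathcomp Require Import classical_sets reals.

Set Implicit Arguments.
Unset Strict Implicit.
Unset Printing Implicit Defensive.

Import Order.TTheory GRing.Theory Num.Theory.
Import ComplexField.Normc.
Local Open Scope ring_scope.
Local Open Scope classical_set_scope.
Local Open Scope complex_scope.
Local Open Scope sesquilinear_scope.

(* [normc : R[i] -> R] is the real-valued modulus. *)
Definition frobenius_norm (R : realType) (m n : nat) (M : 'M[R[i]]_(m, n)) : R :=
  Num.sqrt (\sum_(i < m) \sum_(j < n) normc (M i j) ^+ 2).

Definition singular_values (R : realType) (m n : nat) (M : 'M[R[i]]_(m, n)) :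
    set R :=
  [set s : R | 0 <= s /\ eigenvalue (M^t* *m M) (s ^+ 2)%:C].

(* The set is finite, so [sup] is its maximum (and 0 in the empty case n = 0). *)
Definition spectral_norm (R : realType) (m n : nat) (M : 'M[R[i]]_(m, n)) : R :=
  sup (singular_values M).

Definition pencil_regular_at (R : realType) (n : nat) (E A : 'M[R[i]]_n)
    (z : R[i]) : bool :=
  z *: E - A \in unitmx.

Definition pencil_eigenvalue (R : realType) (n : nat) (E A : 'M[R[i]]_n)
    (z : R[i]) : bool :=
  ~~ pencil_regular_at E A z.

Definition pencil_charpoly (R : realType) (n : nat) (E A : 'M[R[i]]_n) :
    {poly R[i]} :=
  \det ('X *: map_mx polyC E - map_mx polyC A).

Definition pencil_multiplicity (R : realType) (n : nat) (E A : 'M[R[i]]_n)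
    (z : R[i]) : nat :=
  mup z (pencil_charpoly E A).

(* Only meaningful where the pencil is regular: [invmx] is the identity map on
   singular matrices. *)
Definition transfer (R : realType) (n m p : nat) (E A : 'M[R[i]]_n)
    (B : 'M[R[i]]_(n, m)) (C : 'M[R[i]]_(p, n)) (z : R[i]) : 'M[R[i]]_(p, m) :=
  C *m invmx (z *: E - A) *m B.

Definition is_pole (R : realType) (n m p : nat) (E A : 'M[R[i]]_n)
    (B : 'M[R[i]]_(n, m)) (C : 'M[R[i]]_(p, n)) (l : R[i]) : Prop :=
  forall (r K : R), 0 < r ->
  exists z : R[i],
    [/\ pencil_regular_at E A z, 0 < normc (z - l) < r
      & K < frobenius_norm (transfer E A B C z)].

(* [l] is a pole of order [k]: it is a pole, and (z - l)^k H(z) has a finite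
   nonzero limit as z tends to l inside the domain of H.  The limit is written
   with explicit epsilons because [R[i]] carries no topology in the library. *)
Definition is_pole_of_order (R : realType) (n m p : nat) (E A : 'M[R[i]]_n)
    (B : 'M[R[i]]_(n, m)) (C : 'M[R[i]]_(p, n)) (l : R[i]) (k : nat) : Prop :=
  is_pole E A B C l /\
  exists2 L : 'M[R[i]]_(p, m), L != 0 &
    forall e : R, 0 < e ->
    exists2 r : R, 0 < r &
      forall z : R[i], pencil_regular_at E A z -> 0 < normc (z - l) < r ->
        frobenius_norm ((z - l) ^+ k *: transfer E A B C z - L) < e.

(* The multiplicity is the algebraic one. *)
Definition general_position (R : realType) (n m p : nat) (E A : 'M[R[i]]_n)
    (B : 'M[R[i]]_(n, m)) (C : 'M[R[i]]_(p, n)) : Prop :=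
  forall l : R[i], pencil_eigenvalue E A l ->
    is_pole_of_order E A B C l (pencil_multiplicity E A l).

Definition interpolation_data (R : realType) (n S : nat) (E A : 'M[R[i]]_n)
    (zs qs : 'I_S -> R[i]) : Prop :=
  [/\ injective zs, forall j, pencil_regular_at E A (zs j)
    & forall j, qs j != 0].

Definition bary_weight (R : realType) (S : nat) (zs qs : 'I_S -> R[i])
    (z : R[i]) : R[i] :=
  \sum_(j < S) qs j / (z - zs j).

(* At a support point the quotient is extended by its limit H(z_i). *)
Definition barycentric (R : realType) (n m p S : nat) (E A : 'M[R[i]]_n)
    (B : 'M[R[i]]_(n, m)) (C : 'M[R[i]]_(p, n)) (zs qs : 'I_S -> R[i])
    (z : R[i]) : 'M[R[i]]_(p, m) :=
  if z \in codom zs then transfer E A B C z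
  else (bary_weight zs qs z)^-1 *:
       \sum_(j < S) (qs j / (z - zs j)) *: transfer E A B C (zs j).

(* |sum_j q_j / (z - z_j)|^-1, extended by its limit 0 at the support points. *)
Definition bary_weight_inv_norm (R : realType) (S : nat)
    (zs qs : 'I_S -> R[i]) (z : R[i]) : R :=
  if z \in codom zs then 0 else (normc (bary_weight zs qs z))^-1.

Definition relative_error (R : realType) (n m p S : nat) (E A : 'M[R[i]]_n)
    (B : 'M[R[i]]_(n, m)) (C : 'M[R[i]]_(p, n)) (delta : R)
    (zs qs : 'I_S -> R[i]) (z : R[i]) : R :=
  frobenius_norm (barycentric E A B C zs qs z - transfer E A B C z)
  / (frobenius_norm (transfer E A B C z) + delta).

Definition Delta (R : realType) (n m p : nat) (E A : 'M[R[i]]_n)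
    (B : 'M[R[i]]_(n, m)) (C : 'M[R[i]]_(p, n)) (delta : R)
    (Bt : 'M[R[i]]_(n, m)) (z : R[i]) : R :=
  frobenius_norm (C *m invmx (z *: E - A) *m Bt)
  / (frobenius_norm (C *m invmx (z *: E - A) *m B) + delta).

(* Main.v *)
(** With R(z) = (zE - A)^-1, the resolvent identity
    R(w) - R(z) = (z - w) R(z) E R(w) turns the barycentric error into
    C R(z) Bt divided by the barycentric weight, where
    Bt = sum_j q_j E R(z_j) B; the first bound is then submultiplicativity of
    the Frobenius norm together with |M X| <= |M|_* |X|.

    For the global bound, C R(z) E R(w) B = (H(w) - H(z)) / (z - w).  Away from
    w, also at the eigenvalues of the pencil and at infinity, this is dominated
    by |H(z)| + delta, and near w the resolvent is bounded.  Hence Delta is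
    bounded for each of the matrices E R(w) B, and finitely many of them span
    all the possible Bt. *)
Require Import Defs.
From mathcomp Require Import all_boot all_order all_algebra.
From mathcomp Require Import complex.
From mathcomp Require Import boolp classical_sets reals.
From mathcomp Require Import lra.

Import Order.TTheory GRing.Theory Num.Theory.
Local Open Scope ring_scope.
Local Open Scope complex_scope.
Import ComplexField.Normc.
Local Open Scope sesquilinear_scope.

Lemma normc_ge0 {R : realType} (z : R[i]) : 0 <= normc z.
Proof. by case: z => *; apply: sqrtr_ge0. Qed.

(** * Norm axioms and submultiplicativity of the Frobenius norm *)

Section FrobeniusNorm.
Context {R : realType}.
Implicit Types m n p : nat.

Local Notation fro := (@frobenius_norm R _ _).

Lemma frobenius_norm_ge0 {m n} (M : 'M[R[i]]_(m, n)) : 0 <= fro M.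
Proof. exact: sqrtr_ge0. Qed.
Hint Resolve frobenius_norm_ge0 : core.

(** The square is cast into [R[i]], where the Hermitian product [dotmx] takes its values; the next
    two lemmas read the same sum as row products and as a trace. *)
Lemma sqr_frobenius_norm {m n} (M : 'M[R[i]]_(m, n)) :
  (fro M ^+ 2)%:C = \sum_i \sum_j `|M i j| ^+ 2.
Proof.
rewrite sqr_sqrtr; last by do 2![apply: sumr_ge0 => ? _]; apply: sqr_ge0.
by rewrite rmorph_sum; apply: eq_bigr => i _; rewrite rmorph_sum;
   apply: eq_bigr => j _; rewrite rmorphXn.
Qed.

Lemma sqr_frobenius_norm_rows {m n} (M : 'M[R[i]]_(m, n)) :
  (fro M ^+ 2)%:C = \sum_i dotmx (row i M) (row i M).
Proof.
rewrite sqr_frobenius_norm; apply: eq_bigr => i _.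
by rewrite dotmxE mxE; apply: eq_bigr => j _; rewrite !mxE normCK.
Qed.

Lemma sqr_frobenius_norm_tr {m n} (M : 'M[R[i]]_(m, n)) :
  (fro M ^+ 2)%:C = \tr (M^t* *m M).
Proof.
rewrite mxtrace_mulC sqr_frobenius_norm; apply: eq_bigr => i _.
by rewrite mxE; apply: eq_bigr => j _; rewrite !mxE normCK.
Qed.

(** Flattening reduces the norm axioms for matrices to those of the Hermitian norm on row
    vectors. *)
Lemma frobenius_norm_mxvec {m n} (M : 'M[R[i]]_(m, n)) : fro (mxvec M) = fro M.
Proof.
congr Num.sqrt; rewrite big_ord1 pair_big (reindex _ (curry_mxvec_bij _ _)) /=.
by apply: eq_bigr => -[i j] _; rewrite mxvecE.
Qed.

Lemma frobenius_norm_dotmx {n} (v : 'rV[R[i]]_n) : (fro v)%:C = sqrtC (dotmx v v).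
Proof.
apply/eqP; rewrite -(@eqrXn2 _ 2) // ?sqrtC_ge0 ?dnorm_ge0 ?ler0c //.
rewrite sqrtCK -rmorphXn /= sqr_frobenius_norm_rows big_ord1.
by rewrite (_ : row 0 v = v) //; apply/rowP => j; rewrite mxE.
Qed.

Lemma frobenius_normD {m n} (M N : 'M[R[i]]_(m, n)) : fro (M + N) <= fro M + fro N.
Proof.
rewrite -[fro (M + N)]frobenius_norm_mxvec linearD /=.
rewrite -(frobenius_norm_mxvec M) -(frobenius_norm_mxvec N).
rewrite -lecR rmorphD /= !frobenius_norm_dotmx.
exact: triangle_lerif.
Qed.

Lemma frobenius_normZ {m n} (a : R[i]) (M : 'M[R[i]]_(m, n)) :
  fro (a *: M) = normc a * fro M.
Proof.
apply: complexI; rewrite rmorphM /= -(frobenius_norm_mxvec M) -frobenius_norm_mxvec.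
by rewrite linearZ !frobenius_norm_dotmx dnormZ sqrtCM ?nnegrE ?exprn_ge0 ?dnorm_ge0 //
  sqrCK.
Qed.

Lemma frobenius_norm0 {m n} : fro (0 : 'M[R[i]]_(m, n)) = 0.
Proof. by rewrite -(scale0r 0) frobenius_normZ normc0 mul0r. Qed.

Lemma frobenius_normN {m n} (M : 'M[R[i]]_(m, n)) : fro (- M) = fro M.
Proof. by rewrite -scaleN1r frobenius_normZ normcN normc1 mul1r. Qed.

Lemma frobenius_norm_eq0 {m n} (M : 'M[R[i]]_(m, n)) : fro M = 0 -> M = 0.
Proof.
rewrite -frobenius_norm_mxvec => /(congr1 (real_complex R)) /eqP.
by rewrite frobenius_norm_dotmx sqrtC_eq0 dnorm_eq0 mxvec_eq0 => /eqP.
Qed.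

Lemma normc_le_frobenius_norm {m n} (M : 'M[R[i]]_(m, n)) i j :
  normc (M i j) <= fro M.
Proof.
rewrite -ler_sqr ?nnegrE ?sqrtr_ge0 ?normc_ge0 //.
rewrite sqr_sqrtr; last by do 2![apply: sumr_ge0 => ? _]; apply: sqr_ge0.
rewrite (bigD1 i) // (bigD1 j) //= -addrA lerDl.
by apply: addr_ge0; apply: sumr_ge0 => ? _ //; rewrite ?sumr_ge0 // => *; apply: sqr_ge0.
Qed.

(** Cauchy-Schwarz for each entry of the product, a row of [M] against a conjugated column of [N],
    summed over all entries. *)
Lemma frobenius_normM {m n p} (M : 'M[R[i]]_(m, n)) (N : 'M[R[i]]_(n, p)) :
  fro (M *m N) <= fro M * fro N.
Proof.
rewrite -ler_sqr ?nnegrE ?mulr_ge0 // -lecR exprMn (rmorphM _ (fro M ^+ 2)) /=.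
rewrite sqr_frobenius_norm sqr_frobenius_norm_rows.
have -> : (fro N ^+ 2)%:C = \sum_j dotmx ((col j N)^t*) ((col j N)^t*).
  rewrite sqr_frobenius_norm exchange_big; apply: eq_bigr => j _.
  by rewrite dotmxE mxE; apply: eq_bigr => k _; rewrite !mxE conjCK normCKC.
rewrite mulr_suml; apply: ler_sum => i _; rewrite mulr_sumr; apply: ler_sum => j _.
suff -> : (M *m N) i j = dotmx (row i M) ((col j N)^t*) by apply: CauchySchwarz.
by rewrite dotmxE !mxE; apply: eq_bigr => k _; rewrite !mxE conjCK.
Qed.

End FrobeniusNorm.

(** * The spectral norm as an operator bound *)

Section SpectralNorm.
Context {R : realType}.
Implicit Types m n p : nat.

Local Notation fro := (@frobenius_norm R _ _).

(** For an eigenvector [v] of the Gram matrix with eigenvalue r^2, r^2 |v|^2 is the squared norm of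
    [v *m M^t*], so submultiplicativity bounds r by the Frobenius norm of [M^t*]. *)
Lemma has_sup_singular_values {m n} {M : 'M[R[i]]_(m, n)} {s} :
  singular_values M s -> has_sup (singular_values M).
Proof.
move=> Ms; split; first by exists s.
exists (fro (M^t*)) => r [r_ge0 /eigenvalueP[v vG v_neq0]].
have v_gt0 : 0 < fro v.
  by rewrite lt_def frobenius_norm_ge0 andbT; apply: contra_neq v_neq0;
     exact: frobenius_norm_eq0.
rewrite -(ler_pM2r v_gt0) mulrC -[X in X <= _]mulrC.
rewrite -ler_sqr ?nnegrE ?mulr_ge0 ?frobenius_norm_ge0 //.
apply: (@le_trans _ _ (fro (v *m M^t*) ^+ 2)); last first.
  by rewrite ler_sqr ?nnegrE ?mulr_ge0 ?frobenius_norm_ge0 // mulrC frobenius_normM.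
rewrite -lecR exprMn (rmorphM _ (r ^+ 2)) /= !sqr_frobenius_norm_rows !big_ord1.
rewrite -linearZl_LR /=.
suff -> : dotmx ((r ^+ 2)%:C *: row 0 v) (row 0 v) =
          dotmx (row 0 (v *m M^t*)) (row 0 (v *m M^t*)) by [].
by rewrite -linearZ /= -vG !dotmxE !row_mul !trmx_mul !map_mxM !mulmxA trmxCK.
Qed.

Lemma spectral_norm_ge0 {m n} (M : 'M[R[i]]_(m, n)) : 0 <= spectral_norm M.
Proof.
rewrite /spectral_norm; have [->|/set0P[s Ms]] := eqVneq (singular_values M) set0.
  by rewrite sup0.
have [s_ge0 _] := Ms; apply: le_trans s_ge0 _.
by have [_ ?] := has_sup_singular_values Ms; exact: ub_le_sup.
Qed.

(** Diagonalise the Gram matrix [G] by a unitary [P]. Then |M X|^2 is the sum of the squared row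
    norms of [P *m X] weighted by the eigenvalues, and [P] preserves |X|. *)
Lemma frobenius_normM_spectral {m n p} (M : 'M[R[i]]_(m, n)) (X : 'M[R[i]]_(n, p)) :
  fro (M *m X) <= spectral_norm M * fro X.
Proof.
pose G := M^t* *m M.
have G_herm : G^t* = G by rewrite /G trmx_mul map_mxM trmxCK.
have /orthomx_spectralP : G \is normalmx by apply/normalmxP; rewrite G_herm.
set P := spectralmx G; set d := spectral_diag G => G_eq.
have P_unitary : P \is unitarymx := spectral_unitarymx G.
have P_unit := unitarymx_unit P_unitary.
have d_eigen i : row i P *m G = d 0 i *: row i P.
  by rewrite {1}G_eq !mulmxA -row_mul mulmxV // row1 -rowE row_diag_mx -scalemxAl -rowE.
(* Row i of [P] is a unit eigenvector, so [d 0 i] is the squared norm of [row i P *m M^t*]: it is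
   real and nonnegative, hence the square of a singular value. *)
have d_le i : d 0 i <= (spectral_norm M ^+ 2)%:C.
  have Pi1 : dotmx (row i P) (row i P) = 1.
    by move/row_unitarymxP: P_unitary => ->; rewrite eqxx.
  have d_ge0 : 0 <= d 0 i.
    rewrite -[d 0 i]mulr1 -Pi1 -linearZl_LR /= -d_eigen.
    suff -> : dotmx (row i P *m G) (row i P) = dotmx (row i P *m M^t*) (row i P *m M^t*).
      exact: dnorm_ge0.
    by rewrite !dotmxE trmx_mul map_mxM !mulmxA trmxCK.
  have [s s_ge0 d_s] : exists2 s : R, 0 <= s & d 0 i = (s ^+ 2)%:C.
    have /complex_realP[k dk] := ger0_real d_ge0.
    exists (Num.sqrt k); first exact: sqrtr_ge0.
    by rewrite sqr_sqrtr // -ler0c -dk.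
  have Ms : singular_values M s.
    split => //; apply/eigenvalueP; exists (row i P); first by rewrite -d_s.
    move/eqP: Pi1; apply: contraTneq => ->.
    by rewrite dotmxE mul0mx mxE eq_sym oner_eq0.
  rewrite d_s lecR ler_sqr ?nnegrE ?spectral_norm_ge0 //.
  by have [_ ?] := has_sup_singular_values Ms; exact: ub_le_sup.
rewrite -ler_sqr ?nnegrE ?mulr_ge0 ?spectral_norm_ge0 ?frobenius_norm_ge0 //.
rewrite -lecR exprMn (rmorphM _ (spectral_norm M ^+ 2)) /=.
have -> : (fro X ^+ 2)%:C = (fro (P *m X) ^+ 2)%:C.
  rewrite !sqr_frobenius_norm_tr trmx_mul map_mxM mulmxA -invmx_unitary //.
  by rewrite mulmxKV.
have -> : (fro (M *m X) ^+ 2)%:C = \sum_i d 0 i * \sum_j `|(P *m X) i j| ^+ 2.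
  rewrite sqr_frobenius_norm_tr trmx_mul map_mxM mulmxA -(mulmxA _ (M^t*)) -/G G_eq.
  rewrite invmx_unitary // !mulmxA -map_mxM -trmx_mul -!mulmxA mxtrace_mulC.
  apply: eq_bigr => i _; rewrite mxE mulr_sumr; apply: eq_bigr => j _.
  by rewrite mul_diag_mx !mxE normCK mulrA.
rewrite sqr_frobenius_norm mulr_sumr; apply: ler_sum => i _.
by apply: ler_wpM2r; rewrite ?sumr_ge0 // => j _; rewrite exprn_ge0.
Qed.

End SpectralNorm.

(** Greedy extraction of a finite spanning family: as long as some vector of [P] lies outside the
    row space, appending it raises the rank, which cannot exceed [d]. *)
Lemma spanning_rows (F : fieldType) d (P : 'rV[F]_d -> Prop) :
  exists k (M : 'M[F]_(k, d)),
    (forall i, P (row i M)) /\ (forall v, P v -> (v <= M)%MS).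
Proof.
suff [//|[k [M [_ rkM]]]] : (exists k (M : 'M[F]_(k, d)),
    (forall i, P (row i M)) /\ (forall v, P v -> (v <= M)%MS)) \/
  exists k (M : 'M[F]_(k, d)), (forall i, P (row i M)) /\ (d < \rank M)%N.
  by have := rank_leq_col M; rewrite leqNgt rkM.
elim: d.+1 => [|r [|[k [M [PM rkM]]]]]; [|by left|].
  by right; exists 0%N, 0; split=> // -[].
have [spanM|/existsNP[v /not_implyP[Pv /negP vM]]] :=
  EM (forall v, P v -> (v <= M)%MS); first by left; exists k, M.
right; exists (k + 1)%N, (col_mx M v); split=> [i|].
  case: (split_ordP i) => j ->; rewrite ?rowKu ?rowKd //.
  by rewrite (_ : row j v = v) //; apply/rowP => l; rewrite mxE ord1.
apply: (leq_ltn_trans rkM); rewrite -addsmxE; apply: rank_ltmx; rewrite ltmxE addsmxSl.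
by apply: contra vM; apply: submx_trans; apply: addsmxSr.
Qed.

(** Scalar core of the estimate away from w, with a = |H(w)|, h = |H(z)|, d = delta and t = |z - w|.
    It rests on a + h <= (a/d + 1)(h + d). *)
Lemma far_quotient_bound {R : realFieldType} (a h d r t x : R) :
    0 <= a -> 0 <= h -> 0 < d -> 0 < r -> r <= t -> t * x <= a + h ->
  x / (h + d) <= (a / d + 1) / r.
Proof.
move=> a_ge0 h_ge0 d_gt0 r_gt0 le_rt num_le.
have den_gt0 : 0 < h + d by rewrite ltr_wpDl.
rewrite ler_pdivrMr // mulrAC ler_pdivlMr //.
have q_ge0 : 0 <= a / d by rewrite divr_ge0 // ltW.
have -> : (a / d + 1) * (h + d) = a / d * h + a + (h + d).
  by rewrite mulrDl mul1r mulrDr divfK // gt_eqF.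
have := mulr_ge0 q_ge0 h_ge0.
have [x_le0|x_gt0] := leP x 0.
  have : x * r <= 0 by rewrite mulr_le0_ge0 // ltW.
  lra.
have := ler_wpM2r (ltW x_gt0) le_rt; lra.
Qed.

(** * Resolvent estimates, bounds on [Delta], and the barycentric error *)

Section Resolvent.
Context {R : realType} {n : nat} (E A : 'M[R[i]]_n).
Implicit Types w z : R[i].

Local Notation fro := (@frobenius_norm R _ _).
Local Notation resolvent z := (invmx (z *: E - A)).
Local Notation regular := (pencil_regular_at E A).

Lemma resolvent_identity {w z} : regular w -> regular z ->
  resolvent w - resolvent z = (z - w) *: (resolvent z *m E *m resolvent w).
Proof.
move=> w_reg z_reg; rewrite scalemxAl scalemxAr.
have -> : (z - w) *: E = (z *: E - A) - (w *: E - A).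
  by rewrite scalerBl opprB addrA subrK.
by rewrite mulmxBr mulmxBl mulVmx // mul1mx -mulmxA mulmxV // mulmx1.
Qed.

(** The resolvent identity gives |R(z)| <= |R(w)| + |R(z)|/2, and the last term is absorbed on the
    left. *)
Lemma resolvent_bound {w z} : regular w -> regular z ->
  normc (z - w) * fro (E *m resolvent w) <= 2^-1 ->
  fro (resolvent z) <= 2 * fro (resolvent w).
Proof.
move=> w_reg z_reg le_half.
have := frobenius_normD (resolvent w) (- ((z - w) *: (resolvent z *m E *m resolvent w))).
rewrite frobenius_normN -resolvent_identity // opprB.
rewrite addrCA subrr addr0 resolvent_identity //.
rewrite frobenius_normZ -mulmxA => le_sum.
have := frobenius_normM (resolvent z) (E *m resolvent w).
move=> /(ler_wpM2l (normc_ge0 (z - w))); rewrite mulrCA => le_prod.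
have := ler_wpM2l (frobenius_norm_ge0 (resolvent z)) le_half.
lra.
Qed.

Context {m p : nat} (B : 'M[R[i]]_(n, m)) (C : 'M[R[i]]_(p, n)).
Local Notation H := (transfer E A B C).

Lemma transfer_sub {w z} : regular w -> regular z ->
  H w - H z = (z - w) *: (C *m resolvent z *m (E *m resolvent w *m B)).
Proof.
move=> w_reg z_reg.
by rewrite /transfer -mulmxBl -mulmxBr resolvent_identity // -scalemxAr -scalemxAl !mulmxA.
Qed.

Lemma Delta_bounded {delta : R} {w} : 0 < delta -> regular w ->
  exists K, forall z, regular z ->
    Delta E A B C delta (E *m resolvent w *m B) z <= K.
Proof.
move=> delta_gt0 w_reg; set X := E *m resolvent w *m B.
pose e := fro (E *m resolvent w); have e_ge0 : 0 <= e := frobenius_norm_ge0 _.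
(* The radius ensures r e <= 1/2, as [resolvent_bound] requires; the added 1 covers e = 0. *)
pose r := (2 * (e + 1))^-1; have r_gt0 : 0 < r by rewrite invr_gt0; lra.
pose Kfar := (fro (H w) / delta + 1) / r.
pose Knear := fro C * (2 * fro (resolvent w)) * fro X / delta.
exists (Num.max Kfar Knear) => z z_reg; rewrite le_max /Delta -/(H z).
have h_ge0 := frobenius_norm_ge0 (H z).
have den_gt0 : 0 < fro (H z) + delta by rewrite ltr_wpDl.
have [near|far] := leP (normc (z - w)) r; apply/orP; [right|left].
  have res_le : fro (resolvent z) <= 2 * fro (resolvent w).
    apply: resolvent_bound => //; apply: le_trans (ler_wpM2r e_ge0 near) _.
    by rewrite /r mulrC ler_pdivrMr; lra.
  (* Near w the numerator is bounded through the resolvent, and the denominator is at least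
     delta. *)
  apply: ler_pM; rewrite ?frobenius_norm_ge0 ?invr_ge0 ?(ltW den_gt0) //.
    apply: le_trans (frobenius_normM _ _) _; apply: ler_wpM2r; first exact: frobenius_norm_ge0.
    apply: le_trans (frobenius_normM _ _) _; apply: ler_wpM2l => //.
    exact: frobenius_norm_ge0.
  by rewrite lef_pV2 ?posrE // lerDr.
apply: (@far_quotient_bound _ (fro (H w)) (fro (H z)) delta r (normc (z - w))).
- exact: frobenius_norm_ge0.
- exact: h_ge0.
- exact: delta_gt0.
- exact: r_gt0.
- exact: ltW far.
rewrite -frobenius_normZ -transfer_sub // -[fro (H z)]frobenius_normN.
exact: frobenius_normD.
Qed.

Lemma DeltaD {delta X Y z} : 0 < delta ->
  Delta E A B C delta (X + Y) z <= Delta E A B C delta X z + Delta E A B C delta Y z.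
Proof.
move=> delta_gt0; rewrite /Delta -mulrDl mulmxDr ler_wpM2r ?frobenius_normD //.
by rewrite invr_ge0 addr_ge0 ?frobenius_norm_ge0 // ltW.
Qed.

Lemma Delta0 delta z : Delta E A B C delta 0 z = 0.
Proof. by rewrite /Delta mulmx0 frobenius_norm0 mul0r. Qed.

Lemma DeltaZ delta a X z :
  Delta E A B C delta (a *: X) z = normc a * Delta E A B C delta X z.
Proof. by rewrite /Delta -scalemxAr frobenius_normZ mulrA. Qed.

Lemma Delta_sum {delta} {I : finType} {X : I -> 'M_(n, m)} {z} : 0 < delta ->
  Delta E A B C delta (\sum_i X i) z <= \sum_i Delta E A B C delta (X i) z.
Proof.
move=> delta_gt0; elim/big_rec2: _ => [|i y x _ le_xy]; first by rewrite Delta0.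
by rewrite (le_trans (DeltaD delta_gt0)) // lerD2l.
Qed.

Lemma Delta_ge0 delta X z : 0 < delta -> 0 <= Delta E A B C delta X z.
Proof.
by move=> delta_gt0; rewrite divr_ge0 ?addr_ge0 ?frobenius_norm_ge0 // ltW.
Qed.

(* On the finite-dimensional space spanned by the matrices [E (w E - A)^-1 B],
   the seminorm [sup_z Delta] is finite, hence dominated by the Frobenius norm. *)
Lemma Delta_bounded_span {delta : R} : 0 < delta ->
  exists2 K, 0 <= K & forall (I : finType) (w c : I -> R[i]) X z,
    (forall j, regular (w j)) -> regular z ->
    X = \sum_j c j *: (E *m resolvent (w j) *m B) ->
    Delta E A B C delta X z <= K * fro X.
Proof.
move=> delta_gt0.
(* Finitely many nodes w suffice, so one constant can serve every choice of support points and
   weights. *)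
have [k [M [rowM spanM]]] := @spanning_rows _ _ (fun v =>
  exists2 w, regular w & v = mxvec (E *m resolvent w *m B)).
have /choice[K K_bound] i : exists K, forall z, regular z ->
    Delta E A B C delta (vec_mx (row i M)) z <= K.
  by have [w w_reg ->] := rowM i; rewrite mxvecK; exact: Delta_bounded.
have absK i z : regular z -> Delta E A B C delta (vec_mx (row i M)) z <= `|K i|.
  by move=> /K_bound /le_trans; apply; exact: ler_norm.
(* The coordinates of [X] in the spanning family are the entries of [mxvec X *m pinvmx M], each at
   most |X| times the norm of [pinvmx M]. *)
exists (fro (pinvmx M) * \sum_i `|K i|).
  by rewrite mulr_ge0 ?frobenius_norm_ge0 ?sumr_ge0.
move=> I w c X z w_reg z_reg X_sum.
have X_span : (mxvec X <= M)%MS.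
  rewrite X_sum linear_sum; apply: summx_sub => j _; rewrite linearZ.
  by apply: scalemx_sub; apply: spanM; exists (w j).
have X_eq : X = \sum_i (mxvec X *m pinvmx M) 0 i *: vec_mx (row i M).
  rewrite -[LHS]mxvecK -{1}(mulmxKpV X_span) mulmx_sum_row linear_sum.
  by apply: eq_bigr => i _; rewrite linearZ.
rewrite {1}X_eq; apply: le_trans (Delta_sum delta_gt0) _.
rewrite mulrAC mulr_sumr; apply: ler_sum => i _; rewrite DeltaZ.
apply: ler_pM; rewrite ?normc_ge0 ?Delta_ge0 ?absK //.
apply: le_trans (normc_le_frobenius_norm _ _ _) _.
by rewrite mulrC -[fro X]frobenius_norm_mxvec; exact: frobenius_normM.
Qed.

Context {S : nat} (zs qs : 'I_S -> R[i]).

Lemma barycentric_error {z} : interpolation_data E A zs qs -> regular z ->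
    z \notin codom zs -> bary_weight zs qs z != 0 ->
  barycentric E A B C zs qs z - H z =
  (bary_weight zs qs z)^-1 *:
    (C *m resolvent z *m \sum_j qs j *: (E *m resolvent (zs j) *m B)).
Proof.
move=> [_ zs_reg _] z_reg z_zs weight_neq0; rewrite /barycentric (negPf z_zs).
(* Writing H(z) as weight^-1 times weight times H(z) leaves the sum of q_j (H(z_j) - H(z)) / (z -
   z_j), where [transfer_sub] cancels each denominator. *)
rewrite -[H z in LHS](scalerK weight_neq0) -scalerBr; congr (_ *: _).
rewrite scaler_suml -sumrB mulmx_sumr; apply: eq_bigr => j _.
rewrite -scalerBr transfer_sub // scalerA divfK ?scalemxAr //.
by rewrite subr_eq0; apply: contraNneq z_zs => ->; exact: codom_f.
Qed.

End Resolvent.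

Theorem proposition2 (R : realType) (n m p : nat) (E A : 'M[R[i]]_n)
    (B : 'M[R[i]]_(n, m)) (C : 'M[R[i]]_(p, n)) :
  exists (Bt : forall S : nat,
             ('I_S -> R[i]) -> ('I_S -> R[i]) -> 'M[R[i]]_(n, m))
         (gamma : forall S : nat, ('I_S -> R[i]) -> ('I_S -> R[i]) -> R),
  forall delta : R, 0 < delta ->
  (forall (S : nat) (zs qs : 'I_S -> R[i]),
     interpolation_data E A zs qs ->
     [/\ 0 < gamma S zs qs,
         forall z : R[i], pencil_regular_at E A z ->
           (z \in codom zs) || (bary_weight zs qs z != 0) ->
           relative_error E A B C delta zs qs z =
             Delta E A B C delta (Bt S zs qs) z * bary_weight_inv_norm zs qs z
       & forall z : R[i], pencil_regular_at E A z ->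
           Delta E A B C delta (Bt S zs qs) z <=
             gamma S zs qs *
             (spectral_norm (invmx (z *: E - A))
              / (frobenius_norm (C *m invmx (z *: E - A) *m B) + delta))])
  /\
  (general_position E A B C ->
   exists Delta_bar : R -> R,
   forall (S : nat) (zs qs : 'I_S -> R[i]),
     interpolation_data E A zs qs ->
     forall z : R[i], pencil_regular_at E A z ->
       Delta E A B C delta (Bt S zs qs) z <= Delta_bar (gamma S zs qs)).
Proof.
pose Bt S (zs qs : 'I_S -> R[i]) :=
  \sum_j qs j *: (E *m invmx (zs j *: E - A) *m B).
(* The added 1 keeps [gamma] positive when [C] or [Bt] vanishes. *)
pose gamma S (zs qs : 'I_S -> R[i]) :=
  frobenius_norm C * frobenius_norm (Bt S zs qs) + 1.
exists Bt, gamma => delta delta_gt0; split=> [S zs qs data|_].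
  split=> [|z z_reg|z z_reg].
  - by rewrite ltr_wpDl // mulr_ge0 ?frobenius_norm_ge0.
  - rewrite /relative_error /bary_weight_inv_norm.
    have [z_zs _|z_zs /= weight_neq0] := boolP (z \in codom zs).
      (* At a support point both sides are 0 by the limit conventions. *)
      by rewrite /barycentric z_zs subrr frobenius_norm0 mul0r mulr0.
    by rewrite barycentric_error // frobenius_normZ normcV -mulrA mulrC.
  rewrite /Delta mulrA; apply: ler_wpM2r.
    by rewrite invr_ge0 addr_ge0 ?frobenius_norm_ge0 // ltW.
  rewrite -mulmxA; apply: le_trans (frobenius_normM _ _) _.
  apply: (le_trans (ler_wpM2l (frobenius_norm_ge0 C) (frobenius_normM_spectral _ _))).
  by rewrite mulrCA mulrC mulrDl mul1r lerDl spectral_norm_ge0.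
have [K K_ge0 K_bound] := Delta_bounded_span E A B C delta_gt0.
(* Since gamma = |C| |Bt| + 1, the quotient gamma / |C| dominates |Bt|, so the bound sees the
   interpolation data only through gamma. If C = 0, the quotient is 0 by convention and [Delta]
   vanishes too. *)
exists (fun g => K * (g / frobenius_norm C)) => S zs qs [_ zs_reg _] z z_reg.
have [C0|C_neq0] := eqVneq (frobenius_norm C) 0.
  rewrite C0 invr0 !mulr0 /Delta (frobenius_norm_eq0 _ C0) !mul0mx.
  by rewrite frobenius_norm0 mul0r.
apply: le_trans (K_bound _ _ _ _ _ zs_reg z_reg erefl) _.
apply: ler_wpM2l => //; rewrite ler_pdivlMr; last first.
  by rewrite lt_def C_neq0 frobenius_norm_ge0.
by rewrite mulrC lerDl.
Qed.
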